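(* Let $G$ be a ribbon graph and $A\subseteq E(G)$. Then $D(G)+A = D(G^{\tau(A)})$.
   Context: A ribbon graph $G=(V(G),E(G))$ is a surface with boundary represented as the union of two (finite) sets of discs, a set $V(G)$ of vertices and a set $E(G)$ of edges, such that: the vertices and edges intersect in disjoint line segments; each such line segment lies on the boundary of precisely one vertex and precisely one edge; and every edge contains exactly two such line segments. (Equivalently, a graph cellularly embedded in a surface.) For $B\subseteq E(G)$, the spanning ribbon subgraph on $B$ is $(V(G),B)$. Partial Petrial: for $A\subseteq E(G)$, $G^{\tau(A)}$ is the ribbon graph obtained from $G$ by, for each $e\in A$, choosing one of the two arcs $(a,b)$ where $e$ meets a vertex, detaching $e$ from the vertex along that arc (giving two copies of the arc $(a,b)$), and reattaching it by gluing $(a,b)$ to the arc $(b,a)$ with direction reversed; informally, a half-twist is added to each edge of $A$. The edge set of $G^{\tau(A)}$ is identified with $E(G)$. A quasi-tree is a ribbon graph with exactly one boundary component. The delta-matroid of $G$ is the set system $D(G)=(E(G),\mathcal{F})$ where $\mathcal{F}$ consists of the edge sets of the spanning ribbon subgraphs of $G$ that form a quasi-tree when restricted to each connected component of $G$. (A set system is a pair $(E,\mathcal{F})$ with $E$ a finite set and $\mathcal{F}$ a collection of subsets of $E$.) Loop complementation: for a set system $D=(E,\mathcal{F})$ and $e\in E$, $D+e=(E,\mathcal{F}')$ with $\mathcal{F}'=\mathcal{F}\bigtriangleup\{F\cup\{e\}: F\in\mathcal{F}, e\notin F\}$, where $\bigtriangleup$ is symmetric difference. Since $(D+e_1)+e_2=(D+e_2)+e_1$,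 for $A=\{e_1,\ldots,e_n\}\subseteq E$ one defines $D+A=D+e_1+\cdots+e_n$. *)

(* Defs.v *)
From mathcomp Require Import all_boot.

Set Implicit Arguments.
Unset Strict Implicit.
Unset Printing Implicit Defensive.

(** * Ribbon graphs

    A ribbon graph is recorded by its gluing data, with vertex discs indexed by
    [V] and edge discs indexed by [E].  The edge disc [e] meets the vertex discs
    in two line segments [(e, i)], [i : bool], and the segment [(e, i)] has two
    end points, the corners [(e, i, false)] and [(e, i, true)].  The boundary
    circle of the disc [e] runs through its corners in the cyclic order
      (e,false,false)  (e,false,true)  (e,true,false)  (e,true,true),
    alternating between the two line segments and the two free sides of [e]. *)

Definition corner (E : finType) : finType := (E * bool * bool)%type.

Definition corner_edge (E : finType) (x : corner E) : E := x.1.1.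

Definition seg_opp (E : finType) (x : corner E) : corner E :=
  let: (e, i, j) := x in (e, i, ~~ j).

Definition side_opp (E : finType) (x : corner E) : corner E :=
  let: (e, i, j) := x in (e, ~~ i, ~~ j).

(** One step along the boundary of a vertex disc, where [arc] joins the two
    end points of each free arc left by the line segments on that boundary. *)
Definition circ_step (E : finType) (arc : corner E -> corner E) : rel (corner E) :=
  [rel x y | (y == seg_opp x) || (y == arc x)].

(** As the line segments are disjoint, a free arc has two distinct end points.
    Each vertex disc has a single boundary circle, whence [vtxP].  Vertices
    outside the image of [vtx] are the isolated ones. *)
Record ribbonGraph (V E : finType) := RibbonGraph {
  arc : corner E -> corner E;
  vtx : corner E -> V;
  arcK : involutive arc;
  arc_neq : forall x, arc x != x;
  vtxP : forall x y, (vtx x == vtx y) = connect (circ_step arc) x y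
}.

Definition end_vtx (V E : finType) (G : ribbonGraph V E) (e : E) (i : bool) : V :=
  vtx G (e, i, false).

Definition adj (V E : finType) (G : ribbonGraph V E) : rel V :=
  [rel u v | [exists e, [exists i,
     (u == end_vtx G e i) && (v == end_vtx G e (~~ i))]]].

Definition component (V E : finType) (G : ribbonGraph V E) (v : V) : {set V} :=
  [set u | connect (adj G) v u].

Definition edges_in (V E : finType) (G : ribbonGraph V E) (U : {set V}) : {set E} :=
  [set e | [forall i, end_vtx G e i \in U]].

(** * Boundary components

    For [B \subset edges_in G U], the ribbon subgraph [(U, B)] is the union of
    the vertex discs in [U] and the edge discs in [B], as a subsurface of [G].
    Its boundary consists of the free arcs of the vertices in [U], the free
    sides of the edges in [B], the line segments on [U] of the edges outside [B]
    (which are no longer covered by an edge), and the whole boundary circle of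
    each vertex in [U] which meets no edge of [G]. *)

Definition bdry_step (V E : finType) (G : ribbonGraph V E) (B : {set E}) :
    rel (corner E) :=
  [rel x y | (y == arc G x) ||
             (y == if corner_edge x \in B then side_opp x else seg_opp x)].

Definition isolated (V E : finType) (G : ribbonGraph V E) : {set V} :=
  [set v | [forall x, vtx G x != v]].

Definition nb_bdry (V E : finType) (G : ribbonGraph V E) (U : {set V})
    (B : {set E}) : nat :=
  n_comp (bdry_step G B) [set x | vtx G x \in U] + #|U :&: isolated G|.

Definition quasi_tree (V E : finType) (G : ribbonGraph V E) (U : {set V})
    (B : {set E}) : bool :=
  nb_bdry G U B == 1.

(** * Set systems, with ground set the whole finite type [E] *)

Definition set_system (E : finType) := {set {set E}}.

Definition delta_matroid (V E : finType) (G : ribbonGraph V E) : set_system E :=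
  [set B : {set E} | [forall v,
     quasi_tree G (component G v) (B :&: edges_in G (component G v))]].

Definition symdiff (T : finType) (X Y : {set T}) : {set T} :=
  (X :\: Y) :|: (Y :\: X).

Definition loopc (E : finType) (D : set_system E) (e : E) : set_system E :=
  symdiff D [set e |: F | F in D & e \notin F].

Definition loopc_set (E : finType) (D : set_system E) (A : {set E}) : set_system E :=
  foldl (@loopc E) D (enum A).

Lemma in_loopc (E : finType) (D : set_system E) (e : E) (X : {set E}) :
  (X \in loopc D e) = (X \in D) (+) ((e \in X) && (X :\ e \in D)).
Proof.
have -> : (X \in loopc D e)
    = (X \in D) (+) (X \in [set e |: F | F in D & e \notin F]).
  by rewrite !inE; do 2 case: (X \in _).
congr (_ (+) _); apply/imsetP/andP => [[F]|[eX XD]].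
  by rewrite inE => /andP[FD eF] ->; rewrite setU11 setU1K.
by exists (X :\ e); rewrite ?inE ?XD ?eqxx // setD1K.
Qed.

(** The order in which the elements of [A] are used in [loopc_set] is
    immaterial. *)
Lemma loopcC (E : finType) (D : set_system E) (e f : E) :
  loopc (loopc D e) f = loopc (loopc D f) e.
Proof.
apply/setP => X; have [->//|ef] := eqVneq e f.
rewrite !in_loopc !inE (negbTE ef) eq_sym (negbTE ef) /= !setDDl setUC.
by case: (e \in X); case: (f \in X); do 4 case: (_ \in D).
Qed.

(** * Partial Petrial

    For each [e] in [A] the edge disc [e] is detached from its vertex along the
    segment [(e, c e)] and glued back there the other way round: [flip] sends a
    corner of an edge disc to the corner whose place it takes. *)

Section PartialPetrial.
Variables (V E : finType) (c : E -> bool) (A : {set E}).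

Definition flip (x : corner E) : corner E :=
  let: (e, i, j) := x in
  if (e \in A) && (i == c e) then (e, i, ~~ j) else (e, i, j).

Lemma flipK : involutive flip.
Proof.
by move=> [[e i] j] /=; case: ifP => /= ->; rewrite ?negbK.
Qed.

Lemma flip_seg_opp x : flip (seg_opp x) = seg_opp (flip x).
Proof. by case: x => [[e i] j] /=; case: ifP. Qed.

Variable G : ribbonGraph V E.

Definition petrial_arc (x : corner E) : corner E := flip (arc G (flip x)).
Definition petrial_vtx (x : corner E) : V := vtx G (flip x).

Lemma petrial_arcK : involutive petrial_arc.
Proof. by move=> x; rewrite /petrial_arc flipK arcK flipK. Qed.

Lemma petrial_arc_neq x : petrial_arc x != x.
Proof. by rewrite -(inj_eq (can_inj flipK)) flipK arc_neq. Qed.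

Lemma petrial_circ_step x y :
  circ_step petrial_arc x y = circ_step (arc G) (flip x) (flip y).
Proof.
have eq_flip a b : (a == flip b) = (flip a == b).
  by rewrite -[RHS](inj_eq (can_inj flipK)) flipK.
rewrite /circ_step [LHS]/= [RHS]/= /petrial_arc -flip_seg_opp.
by rewrite !(inj_eq (can_inj flipK)) eq_flip.
Qed.

Lemma petrial_vtxP x y :
  (petrial_vtx x == petrial_vtx y) = connect (circ_step petrial_arc) x y.
Proof.
rewrite vtxP; apply/connectP/connectP => [[p pP eq_y]|[p pP ->]].
  exists (map flip p); last by rewrite -[x]flipK last_map -eq_y flipK.
  rewrite -[x]flipK; elim: p (flip x) pP {eq_y} => //= z p IHp t /andP[tz zp].
  by rewrite IHp // andbT; move: (petrial_circ_step (flip t) (flip z));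
     rewrite !flipK => /= ->.
exists (map flip p); last by rewrite last_map.
elim: p x pP => //= z p IHp x /andP[xz zp].
by rewrite IHp // andbT; move: (petrial_circ_step x z) => /= <-.
Qed.

Definition partial_petrial : ribbonGraph V E :=
  RibbonGraph petrial_arcK petrial_arc_neq petrial_vtxP.

End PartialPetrial.

(* Main.v *)
Require Import Defs.
From mathcomp Require Import all_boot zify.

Set Implicit Arguments.
Unset Strict Implicit.
Unset Printing Implicit Defensive.

(** Adding the edges of [A] one at a time reduces the theorem to a single edge
    [e], for which it says the following about each edge set [X] containing
    [e]: [X] is feasible in the partial Petrial at [e] exactly when one, but
    not both, of [X] and [X :\ e] is feasible in [G]
    ([quasi_tree_petrial_in], [delta_matroid_petrial1]).

    The boundary of a spanning ribbon subgraph is traced by walks on corners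
    which alternate between two involutions without fixed points: [arc], and a
    pairing [bdry_pair] of the corners of each edge.  On the four corners of
    [e], the pairing joins the ends of a line segment if [e] is absent, the
    ends of a free side if [e] is present, and the corners that are
    diagonally opposite if [e] is present with a half-twist.  These are the
    three perfect matchings of four points, namely the translations [shift p q]
    by the three nonzero elements of the Klein four-group acting on these
    corners.

    Now leave the four corners of [e] unmatched.  The boundary then becomes
    some closed curves and two arcs, whose four end points are the corners of
    [e] ([fixpoint_partner]); the arcs thus define one of the three matchings
    ([corner_pairing]).  Closing up by this same matching makes two separate
    curves out of the two arcs, and closing up by either of the other two makes
    a single one.  Hence, if there are closed curves disjoint from [e], none of
    the three ribbon graphs has connected boundary, and otherwise exactly two
    of them do ([one_class_reglue]).  In both cases any one of the three truth
    values is the exclusive or of the other two ([one_class_reglue_xor]).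

    The connected components not containing [e] see no difference between
    the three ribbon graphs. *)

(** * Relations with a single class *)

Section OneClass.
Variable T : finType.
Implicit Types (e : rel T) (S : {set T}).

(** On a closed nonempty set this is the condition [n_comp e S == 1] of
    [quasi_tree]; in this form it can be proved or refuted by exhibiting walks,
    with no class ever counted. *)
Definition one_class e S := [forall x in S, forall y in S, connect e x y].

Lemma one_classP e S :
  reflect {in S &, forall x y, connect e x y} (one_class e S).
Proof.
apply: (iffP forall_inP) => [eS x y xS yS | eS x xS].
  by have /forall_inP := eS x xS; apply.
by apply/forall_inP => y; apply: eS.
Qed.

Lemma n_comp_eq1 e S x :
  connect_sym e -> closed e S -> x \in S -> (n_comp e S == 1) = one_class e S.
Proof.
move=> eC eS xS; apply/idP/one_classP => [/eqP n1 y z yS zS | S1].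
  have inR t : t \in S -> root e t \in [predI roots e & S].
    move=> tS; rewrite inE /= -(closed_connect eS (connect_root e t)) tS andbT.
    exact: roots_root.
  have /card_le1_eqP le1 : #|[predI roots e & S]| <= 1 by rewrite -n1.
  by apply/(rootP eC); apply: le1; apply: inR.
have -> : n_comp e S = n_comp e (connect e x).
  apply: eq_n_comp_r => y; apply/idP/idP => [yS|xy]; first exact: S1.
  by rewrite -(closed_connect eS xy).
by rewrite n_comp_connect.
Qed.

Lemma eq_one_class e1 e2 S : e1 =2 e2 -> one_class e1 S = one_class e2 S.
Proof.
move=> e12; apply/one_classP/one_classP => S1 x y xS yS.
  by rewrite -(eq_connect e12) S1.
by rewrite (eq_connect e12) S1.
Qed.

End OneClass.

(** * Walks alternating between two involutions *)

Section AlternatingWalks.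
Variable T : finType.
Implicit Types f g : T -> T.

Definition alt_rel f g : rel T := [rel x y | (y == f x) || (y == g x)].

Lemma alt_connect_ind f g (P : T -> Prop) x y :
    P x -> (forall z, P z -> P (f z) /\ P (g z)) ->
  connect (alt_rel f g) x y -> P y.
Proof.
move=> Px Pfg /connectP[p pP ->] {y}.
elim: p x Px pP => //= z p IHp x /Pfg[Pf Pg] /andP[xz]; apply: IHp.
by case/orP: xz => /eqP->.
Qed.

Lemma alt_connect1l f g x : connect (alt_rel f g) x (f x).
Proof. by apply: connect1; rewrite /alt_rel /= eqxx. Qed.

Lemma alt_connect1r f g x : connect (alt_rel f g) x (g x).
Proof. by apply: connect1; rewrite /alt_rel /= eqxx orbT. Qed.

Lemma alt_connect_sym f g :
  involutive f -> involutive g -> connect_sym (alt_rel f g).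
Proof.
have imp x y : involutive f -> involutive g ->
    connect (alt_rel f g) x y -> connect (alt_rel f g) y x.
  move=> fK gK; apply: (@alt_connect_ind _ _ (fun y => connect _ y x)) => // z zx.
  split; apply: connect_trans _ zx.
    by rewrite -{2}[z]fK alt_connect1l.
  by rewrite -{2}[z]gK alt_connect1r.
by move=> fK gK x y; apply/idP/idP; apply: imp.
Qed.

(** The partial Petrial conjugates [arc] by [flip] and keeps the pairing of the
    corners; conjugating the pairing instead keeps [arc], so that boundaries
    before and after the operation differ at the edge only. *)
Lemma alt_connect_conj f g phi x y : involutive phi ->
  connect (alt_rel (phi \o f \o phi) g) x y
    = connect (alt_rel f (phi \o g \o phi)) (phi x) (phi y).
Proof.
move=> phiK; apply/idP/idP => [|xy].
  apply: (@alt_connect_ind _ _ (fun y => connect _ (phi x) (phi y))) => // z xz.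
  split; apply: connect_trans xz _; rewrite /= ?phiK ?alt_connect1l //.
  by rewrite -{2}[z]phiK alt_connect1r.
rewrite -[y]phiK; move: (phi y) xy => {}y.
apply: (@alt_connect_ind _ _ (fun y => connect _ x (phi y))) => [|z xz].
  by rewrite phiK.
split; apply: connect_trans xz _; rewrite /= ?phiK ?alt_connect1r //.
by rewrite -{2}[z]phiK alt_connect1l.
Qed.

Lemma one_class_conj f g phi (S : {set T}) :
    involutive phi -> (forall x, (phi x \in S) = (x \in S)) ->
  one_class (alt_rel (phi \o f \o phi) g) S
    = one_class (alt_rel f (phi \o g \o phi)) S.
Proof.
move=> phiK phiS; apply/one_classP/one_classP => S1 x y xS yS.
  by rewrite -[x]phiK -[y]phiK -alt_connect_conj // S1 ?phiS.
by rewrite alt_connect_conj // S1 ?phiS.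
Qed.

(** A path has two ends.  The class of a fixed point [a] of [g] is its orbit
    under [p = g \o f], on which [f] and [g] act as reflections: writing [x_k]
    for the [k]-th iterate of [p] at [a], and [n] for the size of the orbit,
    [g] sends [x_k] to [x_(-k)] and [f] sends [x_k] to [x_(-k-1)].  As [f] has
    no fixed point, [n] is even, so that [g] fixes exactly [x_0] and
    [x_(n/2)]. *)
Lemma fixpoint_partner f g a :
    involutive f -> (forall x, f x != x) -> involutive g -> g a = a ->
  exists b, [/\ b != a, g b = b
    & forall z, g z = z -> connect (alt_rel f g) a z = (z == a) || (z == b)].
Proof.
move=> fK f_neq gK ga; pose p x := g (f x).
have p_inj : injective p.
  by move=> x y; rewrite /p => /(can_inj gK) /(can_inj fK).
(* The reflection formulas, without negative exponents. *)
have iter_g k : iter k p (g (iter k p a)) = a.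
  by elim: k => [|k IHk] //; rewrite [iter k.+1 p a]iterS iterSr /p gK fK.
have iter_f k : iter k p (f (iter k p a)) = f a.
  by elim: k => [|k IHk] //; rewrite [iter k.+1 p a]iterS iterSr /p fK gK.
have orbitP z : connect (alt_rel f g) a z -> fconnect p a z.
  apply: (@alt_connect_ind _ _ (fun z => fconnect p a z)) => // y.
  move=> /iter_findex <-.
  set k := findex _ _ _.
  have pC := fconnect_sym p_inj.
  split; rewrite pC; last by rewrite -{2}(iter_g k) fconnect_iter.
  apply: (@connect_trans _ _ (f a)); first by rewrite -(iter_f k) fconnect_iter.
  by rewrite -{2}ga -{2}[a]fK fconnect1.
have walk k : connect (alt_rel f g) a (iter k p a).
  elim: k => //= k IHk; apply: connect_trans IHk _.
  exact: connect_trans (alt_connect1l _ _ _) (alt_connect1r _ _ _).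
pose n := order p a; have pn : iter n p a = a by apply: iter_order.
have n_gt0 : 0 < n by apply: order_gt0.
have iter_inj k : injective (iter k p).
  by elim: k => //= k IHk x y /p_inj /IHk.
have small k : 0 < k < n -> iter k p a != a.
  case/andP=> k0 kn; apply/eqP => pk.
  have := findex_iter kn; rewrite pk findex0 => k_eq.
  by rewrite -k_eq in k0.
have n_even : ~~ odd n.
  (* For n = 2 m + 1, f would send x_m to x_(-m-1) = x_m. *)
  apply/negP => odd_n; have nE : n = (n./2 + n./2).+1 by lia.
  have := f_neq (iter n./2 p a); rewrite -(inj_eq (iter_inj n./2)).
  by rewrite iter_f -iterD -(inj_eq p_inj) -iterS -nE pn /p fK ga eqxx.
have n2 : n = n./2 + n./2 by lia.
have half_bd : 0 < n./2 < n by lia.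
exists (iter n./2 p a); split.
- exact: small.
- by apply: (iter_inj n./2); rewrite iter_g -iterD -n2.
move=> z gz; apply/idP/orP => [/orbitP az | [] /eqP-> //].
set k := findex p a z; have zE : iter k p a = z by apply: iter_findex.
have kn : k < n by apply: findex_max.
have k2 : iter (k + k) p a = a by rewrite iterD zE -{1}gz -zE iter_g.
have [k0|k0] := posnP k; first by left; rewrite -zE k0.
right; suff -> : n./2 = k by rewrite zE.
have [lt_n|gt_n|] := ltngtP (k + k) n; last by lia.
  by have := small (k + k); rewrite k2 eqxx lt_n addn_gt0 k0 => /(_ isT).
have := small (k + k - n).
rewrite -(inj_eq (iter_inj n)) -iterD subnKC ?(ltnW gt_n) //.
by rewrite k2 pn eqxx => H; have /H : 0 < k + k - n < n by lia.
Qed.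

End AlternatingWalks.

(** * The three matchings on the corners of an edge *)

Section EdgeRegluing.
Variable E : finType.
Implicit Types (x y : corner E) (f k : corner E -> corner E).
Implicit Types (e : E) (p q : bool).

Definition shift p q x : corner E :=
  let: (e, i, j) := x in (e, i (+) p, j (+) q).

Lemma shiftK p q : involutive (shift p q).
Proof. by case=> [[e i] j] /=; rewrite !addbK. Qed.

Lemma corner_edge_shift p q x : corner_edge (shift p q x) = corner_edge x.
Proof. by case: x => [[e i] j]. Qed.

(** With [p = q = false] the corners of [e] become fixed points: the walks
    alternating with this pairing stop there. *)
Definition reglue k e p q x := if corner_edge x == e then shift p q x else k x.

Variables (f k : corner E -> corner E) (e : E) (S : {set corner E}).
Hypotheses (fK : involutive f) (f_neq : forall x, f x != x).
Hypotheses (kK : involutive k) (k_neq : forall x, k x != x).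
Hypotheses (k_edge : forall x, corner_edge (k x) = corner_edge x).
Hypothesis eS : forall i j, (e, i, j) \in S.

Let R p q := alt_rel f (reglue k e p q).

Lemma reglueK p q : involutive (reglue k e p q).
Proof.
move=> x; rewrite /reglue; have [xe|xe] := eqVneq (corner_edge x) e.
  by rewrite corner_edge_shift xe eqxx shiftK.
by rewrite k_edge (negbTE xe) kK.
Qed.

Lemma reglueE p q i j : reglue k e p q (e, i, j) = (e, i (+) p, j (+) q).
Proof. by rewrite /reglue /= eqxx. Qed.

Lemma reglue_connect p q p' q' :
    (forall i j, connect (R p' q') (e, i, j) (e, i (+) p, j (+) q)) ->
  forall x y, connect (R p q) x y -> connect (R p' q') x y.
Proof.
move=> eR x y.
apply: (@alt_connect_ind _ _ _ (fun y => connect _ x y)) => // z xz; split.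
  exact: connect_trans xz (alt_connect1l _ _ _).
apply: connect_trans xz _; have [ze|ze] := eqVneq (corner_edge z) e.
  by case: z ze => [[e' i] j]; rewrite /corner_edge /= => ->; rewrite reglueE.
have -> : reglue k e p q z = reglue k e p' q' z by rewrite /reglue (negbTE ze).
exact: alt_connect1r.
Qed.

(** The walks that stop at [e] match its corners, and a perfect matching of four
    points is a translation of the Klein four-group. *)
Lemma corner_pairing : exists p0 q0, (p0 || q0) /\ forall i j i' j',
  connect (R false false) (e, i, j) (e, i', j')
    = ((i (+) i', j (+) j') \in [:: (false, false); (p0, q0)]).
Proof.
have Rsym := alt_connect_sym fK (reglueK false false).
have fix0 i j : reglue k e false false (e, i, j) = (e, i, j).
  by rewrite reglueE !addbF.
have partner i j : exists i1 j1, (i1, j1) != (i, j) /\ forall i' j',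
    connect (R false false) (e, i, j) (e, i', j')
      = ((i', j') == (i, j)) || ((i', j') == (i1, j1)).
  have [b [b_neq gb bP]] :=
    fixpoint_partner fK f_neq (reglueK false false) (fix0 i j).
  have be : corner_edge b = e.
    apply/eqP; apply: contraT => /negbTE be.
    by move: gb (k_neq b); rewrite /reglue be => ->; rewrite eqxx.
  case: b b_neq gb bP be => [[e' i1] j1] b_neq _ bP.
  rewrite /corner_edge /= => be.
  rewrite {e'}be in b_neq bP.
  exists i1, j1; split; first by move: b_neq; rewrite !xpair_eqE eqxx.
  by move=> i' j'; rewrite bP // !xpair_eqE eqxx.
have [p0 [q0 [d_neq aP]]] := partner false false.
exists p0, q0; split; first by case: p0 q0 d_neq {aP} => [] [].
move=> i j i' j'; have [i1 [j1 [b_neq bP]]] := partner i j.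
(* The partner of a third corner is the fourth, since the first corner and its
   partner are both connected to it or both not. *)
have R0 := aP i j; have Rd := R0.
rewrite (same_connect Rsym (_ : connect _ _ (e, p0, q0))) in Rd; last first.
  by rewrite aP eqxx orbT.
rewrite Rsym bP in R0; rewrite Rsym bP in Rd.
rewrite bP !inE; move: d_neq b_neq R0 Rd; clear.
by case: p0 q0 i j i1 j1 i' j' => [] [] // [] [] [] [] [] [].
Qed.

(** The condition on [S] says that each boundary curve in [S] passes through
    [e].  If [shift p q] is the matching [(p0, q0)] given by the two arcs, then
    each arc closes up on itself; otherwise the arcs are joined into one
    curve. *)
Lemma one_class_reglue : exists p0 q0, (p0 || q0) /\ forall p q, p || q ->
  one_class (R p q) S =
    [forall x in S, [exists i, [exists j, connect (R false false) (e, i, j) x]]]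
      && ((p, q) != (p0, q0)).
Proof.
have Rsym p q := alt_connect_sym fK (reglueK p q).
have [p0 [q0 [d_neq pairing]]] := corner_pairing.
exists p0, q0; split=> // p q pq_neq; apply/idP/andP.
  move=> /one_classP S1; split.
    apply/forall_inP => x xS.
    have [i [j ijx]] : exists i j, connect (R false false) (e, i, j) x.
      move: (S1 _ _ (eS false false) xS).
      apply: (@alt_connect_ind _ _ _
        (fun x => exists i j, connect (R false false) (e, i, j) x)).
        by exists false, false; apply: connect0.
      move=> z [i [j ijz]]; split.
        by exists i, j; apply: connect_trans ijz (alt_connect1l _ _ _).
      have [ze|ze] := eqVneq (corner_edge z) e.
        case: z {ijz} ze => [[e' i'] j']; rewrite /corner_edge /= => ->.
        rewrite reglueE.
        by exists (i' (+) p), (j' (+) q); apply: connect0.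
      exists i, j; apply: connect_trans ijz _.
      have -> : reglue k e p q z = reglue k e false false z.
        by rewrite /reglue (negbTE ze).
      exact: alt_connect1r.
    by apply/existsP; exists i; apply/existsP; exists j.
  apply/eqP => -[pE qE]; subst p q.
  have RR : forall x y, connect (R p0 q0) x y -> connect (R false false) x y.
    apply: reglue_connect => i j.
    by rewrite pairing !addKb !inE eqxx orbT.
  (* The corner (~~ p0, p0) differs from (false, false) and, as (p0, q0) is not
     (false, false), also from (p0, q0): it lies on the other arc. *)
  have := RR _ _ (S1 _ _ (eS false false) (eS (~~ p0) p0)).
  by rewrite pairing; case: p0 q0 d_neq {pairing RR S1 pq_neq} => [] [].
case=> /forall_inP Q pq_d; apply/one_classP => x y xS yS.
have RR : forall u v, connect (R false false) u v -> connect (R p q) u v.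
  by apply: reglue_connect => i j; rewrite !addbF.
(* As (p, q) and (p0, q0) are distinct and nonzero, they generate the group. *)
have corners i j i' j' : connect (R p q) (e, i, j) (e, i', j').
  have step_pq i2 j2 : connect (R p q) (e, i2, j2) (e, i2 (+) p, j2 (+) q).
    by rewrite -reglueE; apply: alt_connect1r.
  have step_d i2 j2 : connect (R p q) (e, i2, j2) (e, i2 (+) p0, j2 (+) q0).
    by apply: RR; rewrite pairing !addKb !inE eqxx orbT.
  have step2 := connect_trans (step_pq i j) (step_d _ _).
  have := (step_pq i j, step_d i j, step2, connect0 (R p q) (e, i, j)).
  move: pq_neq pq_d d_neq; clear.
  by case: p q p0 q0 i j i' j' => [] [] [] [] // [] [] [] [] //= _ _ _ [[[]]].
have [/existsP[i /existsP[j ijx]] /existsP[i' /existsP[j' ijy]]] :=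
  (Q x xS, Q y yS).
apply: connect_trans (RR _ _ ijy); apply: connect_trans (corners i j _ _).
by rewrite Rsym; apply: RR.
Qed.

(** Exactly one of the three translations is the exceptional [(p0, q0)]. *)
Lemma one_class_reglue_xor :
  one_class (R true false) S
    = one_class (R true true) S (+) one_class (R false true) S.
Proof.
have [p0 [q0 [d_neq S1]]] := one_class_reglue.
by rewrite !S1 //; case: [forall x in S, _]; case: p0 q0 d_neq {S1} => [] [].
Qed.

End EdgeRegluing.

(** * The boundary of a ribbon subgraph *)

Section Boundary.
Variables V E : finType.
Implicit Types (G : ribbonGraph V E) (U : {set V}) (A B : {set E}).

Definition bdry_pair B (x : corner E) : corner E :=
  if corner_edge x \in B then side_opp x else seg_opp x.

Lemma bdry_pair_edge B x : corner_edge (bdry_pair B x) = corner_edge x.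
Proof. by rewrite /bdry_pair; case: x => [[e i] j] /=; case: ifP. Qed.

Lemma bdry_pairK B : involutive (bdry_pair B).
Proof.
move=> x; rewrite {1}/bdry_pair bdry_pair_edge /bdry_pair.
by case: (_ \in B); case: x => [[e i] j] /=; rewrite !negbK.
Qed.

Lemma bdry_pair_neq B x : bdry_pair B x != x.
Proof.
rewrite /bdry_pair; case: x => [[e i] j] /=.
by case: ifP => _; rewrite !xpair_eqE; case: i j => [] []; rewrite ?andbF.
Qed.

Lemma vtx_seg_opp G x : vtx G (seg_opp x) = vtx G x.
Proof. by apply/esym/eqP; rewrite vtxP connect1 // /circ_step /= eqxx. Qed.

Lemma vtx_arc G x : vtx G (Defs.arc G x) = vtx G x.
Proof. by apply/esym/eqP; rewrite vtxP connect1 // /circ_step /= eqxx orbT. Qed.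

Lemma vtx_end_vtx G e i j : vtx G (e, i, j) = end_vtx G e i.
Proof. by case: j => //; rewrite /end_vtx -vtx_seg_opp. Qed.

Lemma edges_inP G U e :
  reflect (forall i j, vtx G (e, i, j) \in U) (e \in edges_in G U).
Proof.
rewrite inE; apply: (iffP forallP) => eU i.
  by move=> j; rewrite vtx_end_vtx.
by rewrite -(vtx_end_vtx _ _ _ false).
Qed.

Lemma bdry_step_closed G U B : B \subset edges_in G U ->
  closed (bdry_step G B) [set x | vtx G x \in U].
Proof.
move=> /subsetP BU x y; rewrite !inE /= => /orP[]/eqP->; first by rewrite vtx_arc.
case: ifP => [/BU|_]; last by rewrite vtx_seg_opp.
by case: x => [[e i] j] /edges_inP eU; rewrite /= !eU.
Qed.

(** If an edge of [G] meets [U], then some boundary component passes through a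
    corner, so that the isolated vertices of [U], each of which adds another
    boundary component, must be absent. *)
Lemma quasi_treeE G U B (S := [set x | vtx G x \in U]) :
  B \subset edges_in G U ->
  quasi_tree G U B = if S == set0 then #|U :&: isolated G| == 1
    else (U :&: isolated G == set0) && one_class (bdry_step G B) S.
Proof.
move=> BU; rewrite /quasi_tree /nb_bdry -/S.
have BC : connect_sym (bdry_step G B) := alt_connect_sym (arcK G) (@bdry_pairK B).
have Bcl : closed (bdry_step G B) S := bdry_step_closed BU.
have [S0|[x xS]] := set_0Vmem S.
  have -> : n_comp (bdry_step G B) S = 0.
    by apply: eq_card0 => x; rewrite S0 !inE andbF.
  by rewrite S0 eqxx.
have -> : (S == set0) = false by apply/negbTE/set0Pn; exists x.
rewrite -(n_comp_eq1 BC Bcl xS) -cards_eq0.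
have : 0 < n_comp (bdry_step G B) S.
  apply/card_gt0P; exists (root (bdry_step G B) x); rewrite inE /=.
  by rewrite roots_root // -(closed_connect Bcl (connect_root _ x)).
by case: (n_comp _ _) => // n _; rewrite addSn !eqSS addn_eq0 andbC.
Qed.

Section SameVertices.
Variables G1 G2 : ribbonGraph V E.
Hypothesis vtx12 : vtx G1 =1 vtx G2.

Lemma eq_end_vtx e i : end_vtx G1 e i = end_vtx G2 e i.
Proof. exact: vtx12. Qed.

Lemma eq_component v : component G1 v = component G2 v.
Proof.
apply/setP => u; rewrite !inE; apply: eq_connect => {v}u v /=.
by apply: eq_existsb => e; apply: eq_existsb => i; rewrite !eq_end_vtx.
Qed.

Lemma eq_edges_in U : edges_in G1 U = edges_in G2 U.
Proof.
by apply/setP => e; rewrite !inE; apply: eq_forallb => i; rewrite eq_end_vtx.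
Qed.

Lemma eq_isolated : isolated G1 = isolated G2.
Proof.
by apply/setP => v; rewrite !inE; apply: eq_forallb => x; rewrite vtx12.
Qed.

Lemma eq_vtx_preim U : [set x | vtx G1 x \in U] = [set x | vtx G2 x \in U].
Proof. by apply/setP => x; rewrite !inE vtx12. Qed.

Lemma eq_quasi_tree U B :
    B \subset edges_in G2 U ->
    one_class (bdry_step G1 B) [set x | vtx G2 x \in U]
      = one_class (bdry_step G2 B) [set x | vtx G2 x \in U] ->
  quasi_tree G1 U B = quasi_tree G2 U B.
Proof.
move=> BU2 S12; rewrite (quasi_treeE BU2).
have BU1 : B \subset edges_in G1 U by rewrite eq_edges_in.
by rewrite (quasi_treeE BU1) eq_vtx_preim eq_isolated S12.
Qed.

Lemma eq_delta_matroid :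
  Defs.arc G1 =1 Defs.arc G2 -> delta_matroid G1 = delta_matroid G2.
Proof.
move=> arc12; apply: eq_finset => X; apply: eq_forallb => v.
rewrite eq_component eq_edges_in.
apply: eq_quasi_tree (subsetIr _ _) _.
by apply: eq_one_class => x y; rewrite /bdry_step /= arc12.
Qed.

End SameVertices.

(** A flip exchanges the two ends of a line segment, which lie on the same
    vertex.  Thus the partial Petrial keeps components and isolated vertices. *)
Lemma petrial_vtxE c A G : vtx (partial_petrial c A G) =1 vtx G.
Proof.
move=> [[e i] j] /=; rewrite /petrial_vtx /=; case: ifP => // _.
by rewrite -(vtx_seg_opp G (e, i, j)).
Qed.

Section OneEdge.
Variables (c : E -> bool) (e : E) (G : ribbonGraph V E).

Lemma reglue_in B x :
  e \in B -> reglue (bdry_pair B) e true true x = bdry_pair B x.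
Proof.
move=> eB; case: x => [[f i] j]; rewrite /reglue /bdry_pair /corner_edge /=.
by have [->|//] := eqVneq f e; rewrite eB !addbT.
Qed.

Lemma reglue_notin B x :
  reglue (bdry_pair B) e false true x = bdry_pair (B :\ e) x.
Proof.
case: x => [[f i] j]; rewrite /reglue /bdry_pair /corner_edge /= !inE.
by have [->|//] := eqVneq f e; rewrite addbF addbT.
Qed.

Let G' := partial_petrial c [set e] G.

(** Each free side of [e] has one end on the flipped line segment, so that
    conjugation by the flip moves exactly one of its ends, and it becomes a
    diagonal of [e] whichever segment [c e] is chosen.  The ends of a line
    segment are still matched with each other after a flip. *)
Lemma flip_pair B x :
  flip c [set e] (bdry_pair B (flip c [set e] x))
    = if e \in B then reglue (bdry_pair B) e true false x else bdry_pair B x.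
Proof.
case: x => [[f i] j]; rewrite /reglue /bdry_pair /corner_edge /= in_set1.
have [->|fe] := eqVneq f e; last first.
  by rewrite /=; do 2!case: (_ \in B); rewrite /= in_set1 (negbTE fe).
case: i j => [] []; case ce: (c e) => /=; case: (e \in B);
  by rewrite /= ?in_set1 ?eqxx ?ce.
Qed.

Lemma one_class_petrial U B (S := [set x | vtx G x \in U]) :
  one_class (bdry_step G' B) S = one_class (alt_rel (Defs.arc G)
    (fun x => if e \in B then reglue (bdry_pair B) e true false x
              else bdry_pair B x)) S.
Proof.
have flipS x : (flip c [set e] x \in S) = (x \in S).
  by rewrite !inE -[vtx G (flip _ _ x)]/(vtx G' x) petrial_vtxE.
have phiK : involutive (flip c [set e]) := @flipK E c [set e].
rewrite [LHS](one_class_conj (Defs.arc G) (bdry_pair B) phiK flipS).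
by apply: eq_one_class => x y; rewrite /alt_rel /= flip_pair.
Qed.

Lemma quasi_tree_petrial_notin U B : B \subset edges_in G U -> e \notin B ->
  quasi_tree G' U B = quasi_tree G U B.
Proof.
move=> BU eB; apply: eq_quasi_tree => //; first exact: petrial_vtxE.
by rewrite one_class_petrial (negbTE eB).
Qed.

(** The three terms are the three ways to match the corners of [e]: with the
    half-twist, as an untwisted edge, and with [e] removed. *)
Lemma quasi_tree_petrial_in U B : B \subset edges_in G U -> e \in B ->
  quasi_tree G' U B = quasi_tree G U B (+) quasi_tree G U (B :\ e).
Proof.
move=> BU eB; have /edges_inP eU := subsetP BU e eB.
have B'U : B :\ e \subset edges_in G U := subset_trans (subD1set B e) BU.
rewrite !quasi_treeE ?(eq_edges_in (petrial_vtxE c [set e] G)) //.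
rewrite (eq_vtx_preim (petrial_vtxE c [set e] G)).
rewrite (eq_isolated (petrial_vtxE c [set e] G)) one_class_petrial eB.
set S := [set x | _]; have eS i j : (e, i, j) \in S by rewrite inE.
have -> : (S == set0) = false by apply/negbTE/set0Pn; exists (e, true, true).
rewrite (one_class_reglue_xor (arcK G) (arc_neq G) (@bdry_pairK B)
  (@bdry_pair_neq B) (@bdry_pair_edge B) eS).
have -> : one_class (alt_rel (Defs.arc G) (reglue (bdry_pair B) e true true)) S
    = one_class (bdry_step G B) S.
  by apply: eq_one_class => x y; rewrite /bdry_step /alt_rel [LHS]/= reglue_in.
have -> : one_class (alt_rel (Defs.arc G) (reglue (bdry_pair B) e false true)) S
    = one_class (bdry_step G (B :\ e)) S.
  apply: eq_one_class => x y.
  by rewrite /bdry_step /alt_rel [LHS]/= reglue_notin.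
exact: andb_addr.
Qed.

End OneEdge.

End Boundary.

(** * Loop complementation and partial Petrials *)

Section SetSystems.
Variables V E : finType.
Implicit Types (G : ribbonGraph V E) (c : E -> bool) (A : {set E}).

Lemma adj_sym G : symmetric (adj G).
Proof.
move=> u v; apply: eq_existsb => e; apply/existsP/existsP => -[i /andP[ui vi]].
  by exists (~~ i); rewrite negbK vi ui.
by exists (~~ i); rewrite negbK vi ui.
Qed.

Lemma edges_in_component G e v :
  (e \in edges_in G (component G v))
    = (component G v == component G (end_vtx G e false)).
Proof.
have aC := sym_connect_sym (@adj_sym G).
apply/edges_inP/eqP => [ev | vE i j].
  have := ev false false; rewrite inE => v_e.
  by apply/setP => u; rewrite !inE; apply: same_connect aC _ _ v_e u.
rewrite vE inE vtx_end_vtx; case: i => //; apply: connect1 => /=.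
by apply/existsP; exists e; apply/existsP; exists false; rewrite !eqxx.
Qed.

(** Feasibility is a conjunction over the components.  The factors away from
    [e] agree for [X] in both ribbon graphs and for [X :\ e], and conjunction
    with them distributes over the exclusive or at the component of [e]. *)
Lemma delta_matroid_petrial1 c e G :
  delta_matroid (partial_petrial c [set e] G) = loopc (delta_matroid G) e.
Proof.
have := @quasi_tree_petrial_in _ _ c e G.
have := @quasi_tree_petrial_notin _ _ c e G.
have := petrial_vtxE c [set e] G.
move: (partial_petrial c [set e] G) => G' vtxE q_notin q_in.
pose C := component G; pose v0 := end_vtx G e false.
pose q H X v := quasi_tree H (C v) (X :&: edges_in G (C v)).
pose away (r : V -> bool) := [forall v, (C v != C v0) ==> r v].
have eq_away r1 r2 :
    (forall v, C v != C v0 -> r1 v = r2 v) -> away r1 = away r2.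
  move=> r12; apply: eq_forallb => v.
  by case: (C v != C v0) (r12 v) => // ->.
have dmE H X : component H =1 C -> edges_in H =1 edges_in G ->
    (X \in delta_matroid H) = away (q H X) && q H X v0.
  move=> HC He; rewrite in_set.
  have -> : [forall v, quasi_tree H (component H v)
        (X :&: edges_in H (component H v))] = [forall v, q H X v].
    by apply: eq_forallb => v; rewrite /q HC He.
  apply/forallP/andP => [qX | [/forallP qX qX0] v].
    by split=> //; apply/forallP => v; rewrite qX implybT.
  have := qX v; have [vE _|_] := eqVneq (C v) (C v0); last by apply.
  by rewrite /q vE.
have offE v : C v != C v0 -> e \notin edges_in G (C v).
  by rewrite edges_in_component.
have dmG Y := dmE G Y (frefl _) (frefl _).
have dmG' Y := dmE G' Y (eq_component vtxE) (eq_edges_in vtxE).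
apply/setP => X; rewrite [RHS]in_loopc.
have [eX|eX] := boolP (e \in X); last first.
  have qE v : q G' X v = q G X v.
    by apply: q_notin; rewrite ?subsetIr // inE (negbTE eX).
  by rewrite andFb addbF [LHS]dmG' [RHS]dmG qE (eq_away _ (q G X)).
have dmG'X : (X \in delta_matroid G') = away (q G X) && q G' X v0.
  rewrite dmG' (eq_away _ (q G X)) => [//|v /offE ev].
  by apply: q_notin; rewrite ?subsetIr // inE (negbTE ev) andbF.
have dmGXe : (X :\ e \in delta_matroid G) = away (q G X) && q G (X :\ e) v0.
  apply: etrans (dmG _) (congr1 (andb^~ _) _); apply: eq_away => v /offE ev.
  rewrite /q setIDAC (setDidPl _) //.
  by rewrite disjoint_sym disjoints1 inE (negbTE ev) andbF.
have e0 : e \in edges_in G (C v0) by rewrite edges_in_component.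
have qE : q G' X v0 = q G X v0 (+) q G (X :\ e) v0.
  have eX0 : e \in X :&: edges_in G (C v0) by rewrite in_setI eX e0.
  by rewrite /q (q_in _ _ (subsetIr _ _) eX0) setIDAC.
rewrite [LHS]dmG'X (dmG X) dmGXe qE; exact: andb_addr.
Qed.

Lemma delta_matroid_petrialU1 c e A G : e \notin A ->
  delta_matroid (partial_petrial c A (partial_petrial c [set e] G))
    = delta_matroid (partial_petrial c (e |: A) G).
Proof.
move=> eA.
have flip1 x : flip c [set e] (flip c A x) = flip c (e |: A) x.
  case: x => [[f i] j] /=; rewrite !inE; have [->|fe] := eqVneq f e.
    by rewrite (negbTE eA) /= inE eqxx.
  by case: ifP => _; rewrite /= inE (negbTE fe).
have flip2 x : flip c A (flip c [set e] x) = flip c (e |: A) x.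
  by apply: (can_inj (@flipK _ c (e |: A))); rewrite flipK -flip1 !flipK.
apply: eq_delta_matroid => x; first by rewrite !petrial_vtxE.
by rewrite /= /petrial_arc /= /petrial_arc flip1 flip2.
Qed.

Lemma foldl_loopc_petrial c s G : uniq s ->
  foldl (@loopc E) (delta_matroid G) s
    = delta_matroid (partial_petrial c [set e in s] G).
Proof.
elim: s G => [|e s IHs] G /= => [_|/andP[es s_uniq]].
  have flip0 x : flip c [set e in [::]] x = x.
    by case: x => [[e i] j]; rewrite /= inE.
  apply: eq_delta_matroid => x; first by rewrite petrial_vtxE.
  by rewrite /= /petrial_arc !flip0.
have eA : e \notin [set e in s] by rewrite inE.
rewrite set_cons -[RHS](delta_matroid_petrialU1 c G eA).
rewrite -[RHS](IHs _ s_uniq); congr foldl; exact/esym/delta_matroid_petrial1.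
Qed.

End SetSystems.

Theorem theorem4p1 (V E : finType) (G : ribbonGraph V E) (A : {set E})
    (c : E -> bool) :
  loopc_set (delta_matroid G) A = delta_matroid (partial_petrial c A G).
Proof.
by have := foldl_loopc_petrial c G (enum_uniq A); rewrite set_enum.
Qed.
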